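(* For each $\alpha\in\mathbb{R}$, the Bessel function $$J_\alpha(z)=\sum_{m=0}^\infty \frac{(-1)^m}{m!\,\Gamma(m+\alpha+1)}\left(\frac{z}{2}\right)^{2m+\alpha}$$ has infinitely many zeros.
   Context: Here $\Gamma$ is the Gamma function, and $1/\Gamma$ is taken to be the entire function that vanishes at the non-positive integers, so terms with $m+\alpha+1$ a non-positive integer are $0$. The variable $z$ is complex. For non-integer $\alpha$, $z\neq 0$ and the power is understood as $(z/2)^{2m+\alpha}=(z/2)^{\alpha}(z/2)^{2m}$ with the principal branch $(z/2)^\alpha=\exp(\alpha\operatorname{Log}(z/2))$, where $\operatorname{Log}$ is the principal logarithm with argument in $(-\pi,\pi]$; for integer $\alpha$ it is the usual integer power. *)

(* Defs.v *)
From Stdlib Require Import Reals ZArith Ensembles Finite_sets.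
From Coquelicot Require Import Coquelicot.

Open Scope R_scope.

(* Euler's integral of the second kind; it converges for 0 < x. *)
Definition Gamma_integral (x : R) : R :=
  RInt_gen (fun t => Rpower t (x - 1) * exp (- t))
           (at_right 0) (Rbar_locally p_infty).

(* x (x + 1) ... (x + n - 1) *)
Fixpoint rising_factorial (x : R) (n : nat) : R :=
  match n with
  | O => 1
  | S k => rising_factorial x k * (x + INR k)
  end.

(* 1 / Gamma on the whole real line.  [n] is the least natural number with
   0 < x + n, and Gamma is extended to x <= 0 by its functional equation
   Gamma (x + n) = x (x + 1) ... (x + n - 1) Gamma x.  When x is a
   non-positive integer the numerator has a zero factor, so the value is 0. *)
Definition inv_Gamma (x : R) : R :=
  let n := Z.to_nat (up (- x)) in
  rising_factorial x n / Gamma_integral (x + INR n).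

Definition Cexp (z : C) : C := (exp (Re z) * cos (Im z), exp (Re z) * sin (Im z)).

(* Principal argument of z <> 0, with values in (-PI, PI]. *)
Definition Arg (z : C) : R :=
  if Rle_dec 0 (Im z) then acos (Re z / Cmod z) else - acos (Re z / Cmod z).

Definition Clog (z : C) : C := (ln (Cmod z), Arg z).

Definition CpowZ (z : C) (k : Z) : C :=
  match k with
  | Z0 => RtoC 1
  | Zpos p => Cpow z (Pos.to_nat p)
  | Zneg p => Cinv (Cpow z (Pos.to_nat p))
  end.

Definition is_integer (a : R) : Prop := frac_part a = 0.

(* w^(2 m + alpha): the usual integer power if alpha is an integer, and the
   principal branch otherwise. *)
Definition Bessel_power (alpha : R) (m : nat) (w : C) : C :=
  if Req_dec_T (frac_part alpha) 0
  then CpowZ w (2 * Z.of_nat m + Int_part alpha)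
  else Cmult (Cexp (Cmult (RtoC alpha) (Clog w))) (Cpow w (2 * m)).

Definition BesselJ_term (alpha : R) (z : C) (m : nat) : C :=
  Cmult (RtoC ((-1) ^ m / INR (fact m) * inv_Gamma (INR m + alpha + 1)))
        (Bessel_power alpha m (Cdiv z (RtoC 2))).

Definition CSeries (a : nat -> C) : C :=
  (Series (fun n => Re (a n)), Series (fun n => Im (a n))).

Definition BesselJ (alpha : R) (z : C) : C := CSeries (BesselJ_term alpha z).

(* For non-integer alpha the function lives on z <> 0.  For integer alpha
   z = 0 is allowed: a negative power of 0 only occurs in a term whose
   coefficient 1 / Gamma (m + alpha + 1) is 0. *)
Definition BesselJ_zeros (alpha : R) : Ensemble C :=
  fun z => (is_integer alpha \/ z <> RtoC 0) /\ BesselJ alpha z = RtoC 0.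

(* Main.v *)
Require Import Defs.
From Stdlib Require Import Reals Lra Lia ZArith Ensembles Finite_sets.
From Coquelicot Require Import Coquelicot.

(** There are already infinitely many zeros on the positive real axis, by
    Sturm comparison.  For [x > 0] the power [(x/2)^alpha] factors out of the
    series: [J_alpha(x)] is a complex constant times [E(x^2/4)], where
    [E(y) = sum (-1)^m / (m! Gamma(m + alpha + 1)) y^m] is an entire function
    with real coefficients ([BesselJ_real]).  It therefore suffices that
    [E(x^2/4)] vanishes for arbitrarily large real [x].

    The recursion [1/Gamma(x) = x * 1/Gamma(x + 1)], valid on the whole real
    line ([inv_Gamma_succ]), yields the recursion of the coefficients.  This
    gives an infinite radius of convergence and the differential equation
    [y E'' + (alpha + 1) E' + E = 0] ([bessel_clifford_ode]).

    Then [u(x) = x^(alpha + 1/2) E(x^2/4)] satisfies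
    [u'' + (1 - (alpha^2 - 1/4) / x^2) u = 0].  Once [x >= 2 |alpha|], the
    coefficient of [u] exceeds [1/4], so [u] oscillates at least as fast as
    [v(x) = sin((x - a)/2)]: were [u] positive on [[a, a + 2 PI]], the
    Wronskian [u' v - u v'] would be non-increasing there, although it is
    [- u(a)/2 < 0] on the left and [u(a + 2 PI)/2 > 0] on the right
    ([not_pos_on_period_of_bessel_ode]).  Hence [E(x^2/4)] has a zero beyond
    any bound ([zero_of_bessel_ode]), whereas a finite set is bounded.

    The analytic input on [Gamma] is its functional equation on
    [x > 0], which is integration by parts together with the convergence of
    Euler's integral ([Gamma_integral_succ]). *)

Open Scope R_scope.

(** * The functional equation of Gamma *)

(** The integrals over [[a, b]] grow with the interval, so their supremum is the
    improper integral; both endpoints are treated at once. *)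
Lemma ex_RInt_gen_bounded (f : R -> R) (M : R) :
  (forall t, 0 < t -> continuous f t) ->
  (forall t, 0 < t -> 0 <= f t) ->
  (forall a b, 0 < a <= b -> RInt f a b <= M) ->
  exists l, is_RInt_gen f (at_right 0) (Rbar_locally p_infty) l.
Proof.
  intros Hc Hpos HM.
  assert (Hex : forall a b, 0 < a -> 0 < b -> ex_RInt f a b).
  { intros a b Ha Hb. apply (@ex_RInt_continuous R_CompleteNormedModule).
    intros t [Ht _]. apply Hc. revert Ht. unfold Rmin. destruct (Rle_dec a b); lra. }
  assert (Hnn : forall a b, 0 < a <= b -> 0 <= RInt f a b).
  { intros a b Hab. apply RInt_ge_0; [lra | apply Hex; lra |].
    intros t Ht. apply Hpos. lra. }
  assert (Hmono : forall a a' b' b, 0 < a <= a' -> a' <= b' -> b' <= b ->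
            RInt f a' b' <= RInt f a b).
  { intros a a' b' b H1 H2 H3.
    rewrite <- (RInt_Chasles f a a' b) by (apply Hex; lra).
    rewrite <- (RInt_Chasles f a' b' b) by (apply Hex; lra).
    assert (0 <= RInt f a a') by (apply Hnn; lra).
    assert (0 <= RInt f b' b) by (apply Hnn; lra).
    unfold plus; simpl. lra. }
  destruct (completeness (fun v => exists a b, 0 < a <= b /\ v = RInt f a b))
    as [l [Hub Hlub]].
  - exists M. intros v (a & b & Hab & ->). now apply HM.
  - exists (RInt f 1 1), 1, 1. split; [lra | reflexivity].
  - exists l. apply (filterlimi_locally (fun ab => is_RInt f (fst ab) (snd ab))).
    intros eps.
    assert (Hnear : exists a0 b0, 0 < a0 <= b0 /\ l - eps < RInt f a0 b0).
    { destruct (Classical_Prop.classic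
        (exists a0 b0, 0 < a0 <= b0 /\ l - eps < RInt f a0 b0)) as [H | H]; [exact H |].
      exfalso. assert (l <= l - eps); [| destruct eps; simpl in *; lra].
      apply Hlub. intros v (a & b & Hab & ->). apply Rnot_lt_le. intros Hlt.
      apply H. now exists a, b. }
    destruct Hnear as (a0 & b0 & Hab0 & Hl).
    apply (Filter_prod _ _ _ (fun a => 0 < a < a0) (fun b => b0 < b)).
    + exists (mkposreal a0 (proj1 Hab0)). simpl. intros a Ha Hp.
      unfold ball in Ha; simpl in Ha; unfold AbsRing_ball, abs, minus, plus, opp in Ha;
        simpl in Ha.
      rewrite Ropp_0, Rplus_0_r, Rabs_pos_eq in Ha; lra.
    + now exists b0.
    + intros a b Ha Hb. exists (RInt f a b). simpl. split.
      * apply (@RInt_correct R_CompleteNormedModule). apply Hex; lra.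
      * change (Rabs (RInt f a b - l) < eps). apply Rabs_def1.
        -- assert (RInt f a b <= l) by (apply Hub; exists a, b; split; [lra | easy]).
           destruct eps; simpl in *; lra.
        -- assert (RInt f a0 b0 <= RInt f a b) by (apply Hmono; lra). lra.
Qed.

Lemma exp_le_compat (x y : R) : x <= y -> exp x <= exp y.
Proof.
  intros [H | ->]; [left; now apply exp_increasing | apply Rle_refl].
Qed.

(** This is [ln s <= s - 1] at [s = t / (2 x)].  The scale [2 x] is the one that
    turns [x s] into [t / 2]. *)
Lemma Rpower_le_exp_half (x t : R) :
  0 < x -> 0 < t -> Rpower t x <= Rpower (2 * x) x * exp (t / 2).
Proof.
  intros Hx Ht. unfold Rpower. rewrite <- exp_plus. apply exp_le_compat.
  assert (Hln : ln (t / (2 * x)) <= t / (2 * x) - 1).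
  { assert (0 < t / (2 * x)) by (apply Rdiv_lt_0_compat; lra).
    generalize (exp_ineq1_le (ln (t / (2 * x)))). rewrite exp_ln by assumption. lra. }
  rewrite Rcomplements.ln_div in Hln by lra.
  apply (Rmult_le_compat_l x) in Hln; [| lra].
  replace (x * (t / (2 * x) - 1)) with (t / 2 - x) in Hln by (field; lra).
  lra.
Qed.

(** The boundary term [t^x exp(-t)] of the integration by parts; at exponent
    [x - 1] it is the integrand of [Gamma_integral x]. *)
Definition gamma_boundary (x t : R) : R := Rpower t x * exp (- t).

Lemma is_derive_gamma_boundary (x t : R) : 0 < t ->
  is_derive (gamma_boundary x) t
    (x * (Rpower t (x - 1) * exp (- t)) - Rpower t x * exp (- t)).
Proof.
  intros Ht. unfold gamma_boundary, Rpower. auto_derive; [lra |].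
  replace ((x - 1) * ln t) with (x * ln t + - ln t) by ring.
  rewrite exp_plus, (exp_Ropp (ln t)), exp_ln by lra. field. lra.
Qed.

Lemma gamma_boundary_le (x t : R) : 0 < x -> 0 < t ->
  gamma_boundary x t <= Rpower (2 * x) x * exp (- (t / 2)).
Proof.
  intros Hx Ht. unfold gamma_boundary.
  replace (exp (- (t / 2))) with (exp (t / 2) * exp (- t))
    by (rewrite <- exp_plus; f_equal; field).
  rewrite <- Rmult_assoc. apply Rmult_le_compat_r; [left; apply exp_pos |].
  now apply Rpower_le_exp_half.
Qed.

Lemma gamma_boundary_pos (x t : R) : 0 < gamma_boundary x t.
Proof. unfold gamma_boundary, Rpower. apply Rmult_lt_0_compat; apply exp_pos. Qed.

Lemma continuous_gamma_integrand (x t : R) : 0 < t ->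
  continuous (fun t => Rpower t (x - 1) * exp (- t)) t.
Proof.
  intros Ht. apply (ex_derive_continuous (gamma_boundary (x - 1))).
  eexists. now apply is_derive_gamma_boundary.
Qed.

(** The integrand [t^(x-1) exp(-t)] is at most the derivative of
    [F(t) = (t^x exp(-t) - 2 K exp(-t/2)) / x] as soon as
    [t^x exp(-t) <= K exp(-t/2)], and [F] is bounded.  A single comparison thus
    covers both ends of the half-line. *)
Lemma ex_gamma_integral (x : R) : 0 < x -> exists l,
  is_RInt_gen (fun t => Rpower t (x - 1) * exp (- t))
    (at_right 0) (Rbar_locally p_infty) l.
Proof.
  intros Hx. set (K := Rpower (2 * x) x).
  assert (HK : 0 < K) by apply exp_pos.
  apply (ex_RInt_gen_bounded _ (/ x * (3 * K))).
  - apply continuous_gamma_integrand.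
  - intros t Ht. left. apply (gamma_boundary_pos (x - 1)).
  - intros a b Hab.
    set (F := fun t => / x * (gamma_boundary x t - 2 * K * exp (- (t / 2)))).
    set (dF := fun t => / x * ((x * (Rpower t (x - 1) * exp (- t)) - gamma_boundary x t)
                 + K * exp (- (t / 2)))).
    assert (HF : is_RInt dF a b (minus (F b) (F a))).
    { apply (@is_RInt_derive R_CompleteNormedModule); rewrite Rmin_left, Rmax_right by lra; intros t Ht.
      - unfold F, dF. apply (is_derive_scal _ t (/ x)).
        apply (is_derive_ext (fun t => plus (gamma_boundary x t) (- 2 * K * exp (- (t / 2))))).
        { intros u. unfold plus; simpl. ring. }
        apply (is_derive_plus (gamma_boundary x)); [apply is_derive_gamma_boundary; lra |].
        auto_derive; [easy |]. change (t * / 2) with (t / 2). field.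
      - unfold dF. apply (continuous_mult (fun _ => / x)); [apply continuous_const |].
        apply (continuous_plus (fun t => x * (Rpower t (x - 1) * exp (- t)) - gamma_boundary x t)
          (fun t => K * exp (- (t / 2)))).
        + apply (continuous_minus (fun t => x * (Rpower t (x - 1) * exp (- t)))
            (gamma_boundary x)).
          * apply (continuous_mult (fun _ => x)); [apply continuous_const |].
            apply continuous_gamma_integrand. lra.
          * apply (ex_derive_continuous (gamma_boundary x)).
            eexists; apply is_derive_gamma_boundary. lra.
        + apply (ex_derive_continuous (fun t => K * exp (- (t / 2)))). auto_derive. easy. }
    apply Rle_trans with (F b - F a).
    + rewrite <- (is_RInt_unique _ _ _ _ HF : _ = F b - F a).
      apply RInt_le; [lra | | now exists (minus (F b) (F a)) |].
      * apply (@ex_RInt_continuous R_CompleteNormedModule).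
        rewrite Rmin_left, Rmax_right by lra. intros t Ht.
        apply continuous_gamma_integrand. lra.
      * intros t Ht. unfold dF.
        assert (gamma_boundary x t <= K * exp (- (t / 2))) by (apply gamma_boundary_le; lra).
        replace (Rpower t (x - 1) * exp (- t))
          with (/ x * (x * (Rpower t (x - 1) * exp (- t)))) at 1 by (field; lra).
        apply Rmult_le_compat_l; [left; now apply Rinv_0_lt_compat | lra].
    + unfold F. rewrite <- Rmult_minus_distr_l.
      apply Rmult_le_compat_l; [left; now apply Rinv_0_lt_compat |].
      assert (He : forall t, 0 < t -> 0 < K * exp (- (t / 2)) <= K).
      { intros t Ht. split; [apply Rmult_lt_0_compat; [easy | apply exp_pos] |].
        rewrite <- (Rmult_1_r K) at 2. apply Rmult_le_compat_l; [lra |].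
        rewrite <- exp_0. apply exp_le_compat. lra. }
      assert (Ha := He a ltac:(lra)). assert (Hb := He b ltac:(lra)).
      assert (Hga := gamma_boundary_pos x a).
      assert (Hgb := gamma_boundary_le x b Hx ltac:(lra)). fold K in Hgb. lra.
Qed.

Lemma gamma_boundary_lim_0 (x : R) : 0 < x ->
  filterlim (gamma_boundary x) (at_right 0) (locally 0).
Proof.
  intros Hx. apply filterlim_locally. intros eps.
  (* The radius is [eps^(1/x)]. *)
  exists (mkposreal _ (exp_pos (ln eps / x))). simpl. intros t Ht Hpos.
  unfold ball in Ht; simpl in Ht; unfold AbsRing_ball, abs, minus, plus, opp in Ht;
    simpl in Ht.
  rewrite Ropp_0, Rplus_0_r, Rabs_pos_eq in Ht by lra.
  change (Rabs (gamma_boundary x t - 0) < eps).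
  rewrite Rminus_0_r, Rabs_pos_eq by (left; apply gamma_boundary_pos).
  apply Rle_lt_trans with (Rpower t x).
  - unfold gamma_boundary. rewrite <- (Rmult_1_r (Rpower t x)) at 2.
    apply Rmult_le_compat_l; [left; apply exp_pos |].
    rewrite <- exp_0. apply exp_le_compat. lra.
  - unfold Rpower. rewrite <- (exp_ln eps) by apply cond_pos.
    apply exp_increasing. apply (Rmult_lt_reg_l (/ x)); [now apply Rinv_0_lt_compat |].
    rewrite <- Rmult_assoc, Rinv_l, Rmult_1_l by lra.
    rewrite Rmult_comm. apply exp_lt_inv. rewrite exp_ln by lra. exact Ht.
Qed.

Lemma gamma_boundary_lim_infty (x : R) : 0 < x ->
  filterlim (gamma_boundary x) (Rbar_locally p_infty) (locally 0).
Proof.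
  intros Hx. apply filterlim_locally. intros eps.
  set (K := Rpower (2 * x) x).
  assert (HK : 0 < K) by apply exp_pos.
  exists (Rmax 0 (- 2 * ln (eps / K))). intros t Ht.
  apply Rmax_Rlt in Ht.
  change (Rabs (gamma_boundary x t - 0) < eps).
  rewrite Rminus_0_r, Rabs_pos_eq by (left; apply gamma_boundary_pos).
  apply Rle_lt_trans with (K * exp (- (t / 2))); [apply gamma_boundary_le; lra |].
  replace (pos eps) with (K * (eps / K)) by (field; lra).
  apply Rmult_lt_compat_l; [easy |].
  rewrite <- (exp_ln (eps / K)) by (apply Rdiv_lt_0_compat; [apply cond_pos | easy]).
  apply exp_increasing. lra.
Qed.

(** Integrate [(t^x exp(-t))' = x t^(x-1) exp(-t) - t^x exp(-t)]; the boundary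
    terms vanish. *)
Lemma Gamma_integral_succ (x : R) : 0 < x ->
  Gamma_integral (x + 1) = x * Gamma_integral x.
Proof.
  intros Hx. destruct (ex_gamma_integral x Hx) as [l Hl].
  unfold Gamma_integral.
  rewrite (is_RInt_gen_unique _ _ Hl : _ = l).
  apply (is_RInt_gen_unique (fun t => Rpower t (x + 1 - 1) * exp (- t))).
  assert (Hpos : filter_prod (at_right 0) (Rbar_locally p_infty)
            (fun ab => 0 < fst ab /\ 0 < snd ab)).
  { apply (Filter_prod _ _ _ (fun a => 0 < a) (fun b => 0 < b)).
    - exists (mkposreal 1 Rlt_0_1). easy.
    - now exists 0.
    - easy. }
  assert (Hd : forall t, 0 < t -> ex_derive (gamma_boundary x) t).
  { intros t Ht. eexists. now apply is_derive_gamma_boundary. }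
  assert (Hb : is_RInt_gen (Derive (gamma_boundary x)) (at_right 0)
            (Rbar_locally p_infty) (0 - 0)).
  { apply is_RInt_gen_Derive.
    - revert Hpos. apply filter_imp. intros [a b] [Ha Hb] t [Ht _]. simpl in *.
      apply Hd. revert Ht. apply Rlt_le_trans. now apply Rmin_pos.
    - revert Hpos. apply filter_imp. intros [a b] [Ha Hb] t [Ht _]. simpl in *.
      assert (H0 : 0 < t) by (revert Ht; apply Rlt_le_trans; now apply Rmin_pos).
      apply (continuous_ext_loc _
        (fun t => x * (Rpower t (x - 1) * exp (- t)) - Rpower t x * exp (- t))).
      + exists (mkposreal t H0). simpl. intros u Hu.
        symmetry. apply is_derive_unique. apply is_derive_gamma_boundary.
        change (Rabs (u - t) < t) in Hu. apply Rabs_def2 in Hu. lra.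
      + apply (continuous_minus (fun t => x * (Rpower t (x - 1) * exp (- t)))
            (gamma_boundary x)).
        * apply (continuous_mult (fun _ => x)); [apply continuous_const |].
          now apply continuous_gamma_integrand.
        * apply (ex_derive_continuous (gamma_boundary x)). now apply Hd.
    - now apply gamma_boundary_lim_0.
    - now apply gamma_boundary_lim_infty. }
  assert (H := is_RInt_gen_minus _ _ _ _ (is_RInt_gen_scal _ x _ Hl) Hb).
  replace (x * l) with (minus (scal x l) (0 - 0) : R)
    by (unfold minus, plus, opp, scal; simpl; unfold mult; simpl; ring).
  revert H. apply is_RInt_gen_ext.
  revert Hpos. apply filter_imp. intros [a b] [Ha Hb'] t [Ht _]. simpl in *.
  assert (H0 : 0 < t) by (revert Ht; apply Rlt_trans; now apply Rmin_pos).
  rewrite (is_derive_unique _ _ _ (is_derive_gamma_boundary x t H0)).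
  unfold minus, plus, opp, scal; simpl; unfold mult; simpl.
  replace (x + 1 - 1) with x by ring. ring.
Qed.

Lemma rising_factorial_S (x : R) (n : nat) :
  rising_factorial x (S n) = x * rising_factorial (x + 1) n.
Proof.
  induction n as [|n IH]; [simpl; ring |].
  change (rising_factorial x (S (S n)))
    with (rising_factorial x (S n) * (x + INR (S n))).
  rewrite IH, S_INR. simpl. ring.
Qed.

(** For [x <= 0] both sides use the same value of [Gamma_integral], because the
    shift [x + n] is the same, and only the rising factorials differ.  For
    [0 < x] this is the functional equation, inverted; [/ (x * Gamma x)] splits
    even at a zero of [Gamma] thanks to [/ 0 = 0]. *)
Lemma inv_Gamma_succ (x : R) : inv_Gamma x = x * inv_Gamma (x + 1).
Proof.
  unfold inv_Gamma. destruct (archimed (- x)) as [Hup1 Hup2].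
  destruct (Rlt_le_dec 0 x) as [Hx | Hx].
  - destruct (archimed (- (x + 1))) as [Hup3 Hup4].
    assert (H1 : (up (- x) < 1)%Z) by (apply lt_IZR; lra).
    assert (H2 : (up (- (x + 1)) < 1)%Z) by (apply lt_IZR; lra).
    replace (Z.to_nat (up (- x))) with O by lia.
    replace (Z.to_nat (up (- (x + 1)))) with O by lia.
    simpl. rewrite !Rplus_0_r, (Gamma_integral_succ x Hx).
    unfold Rdiv. rewrite Rinv_mult, <- Rmult_assoc, (Rmult_comm x), Rmult_assoc.
    rewrite <- (Rmult_assoc x), Rinv_r by lra. ring.
  - assert (H1 : (0 < up (- x))%Z) by (apply lt_IZR; lra).
    rewrite <- (tech_up (- (x + 1)) (up (- x) - 1)) by (rewrite minus_IZR; lra).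
    replace (Z.to_nat (up (- x))) with (S (Z.to_nat (up (- x) - 1))) by lia.
    rewrite rising_factorial_S, S_INR. unfold Rdiv. rewrite Rmult_assoc.
    replace (x + 1 + INR (Z.to_nat (up (- x) - 1)))
      with (x + (INR (Z.to_nat (up (- x) - 1)) + 1)) by ring.
    reflexivity.
Qed.

(** * The entire factor of the Bessel function *)

Definition bessel_coeff (alpha : R) (m : nat) : R :=
  (-1) ^ m / INR (fact m) * inv_Gamma (INR m + alpha + 1).

Lemma bessel_coeff_rec (alpha : R) (m : nat) :
  (INR m + 1) * (INR m + 1 + alpha) * bessel_coeff alpha (S m) = - bessel_coeff alpha m.
Proof.
  unfold bessel_coeff. rewrite (inv_Gamma_succ (INR m + alpha + 1)).
  rewrite fact_simpl, mult_INR, S_INR.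
  replace (INR m + 1 + alpha + 1) with (INR m + alpha + 1 + 1) by ring.
  simpl. field. split; [apply INR_fact_neq_0 | generalize (pos_INR m); lra].
Qed.

Lemma bounded_of_eventually_decreasing (u : nat -> R) (N : nat) :
  (forall n, (N <= n)%nat -> Rabs (u (S n)) <= Rabs (u n)) ->
  exists M, forall n, Rabs (u n) <= M.
Proof.
  intros Hdec. revert u Hdec. induction N as [|N IH]; intros u Hdec.
  - exists (Rabs (u O)). intros n. induction n as [|n IHn]; [lra |].
    eapply Rle_trans; [apply Hdec; lia | exact IHn].
  - destruct (IH (fun n => u (S n))) as [M HM].
    { intros n Hn. apply Hdec. lia. }
    exists (Rmax M (Rabs (u O))). intros [|n]; [apply Rmax_r |].
    eapply Rle_trans; [apply HM | apply Rmax_l].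
Qed.

(** By the recursion, [|c_n r^n|] decreases once [n > |alpha| + |r|], so it is
    bounded for every [r].  Unlike the ratio test this allows vanishing
    coefficients, which occur when [alpha] is a negative integer. *)
Lemma CV_radius_bessel_coeff (alpha : R) : CV_radius (bessel_coeff alpha) = p_infty.
Proof.
  assert (H : forall r : R, Rbar_le r (CV_radius (bessel_coeff alpha))).
  { intros r. apply (proj1 (CV_radius_bounded (bessel_coeff alpha))).
    destruct (INR_unbounded (Rabs alpha + Rabs r)) as [N HN].
    apply (bounded_of_eventually_decreasing _ N). intros n Hn.
    apply le_INR in Hn.
    assert (Hr := Rabs_pos r). assert (Ha := Rabs_maj2 alpha). assert (Ha' := Rabs_pos alpha).
    assert (Hn0 := pos_INR n).
    replace (bessel_coeff alpha n) with
      (- ((INR n + 1) * (INR n + 1 + alpha) * bessel_coeff alpha (S n)))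
      by (rewrite bessel_coeff_rec; ring).
    rewrite !Rabs_mult, Rabs_Ropp, !Rabs_mult. simpl pow. rewrite Rabs_mult.
    rewrite (Rabs_pos_eq (INR n + 1)), (Rabs_pos_eq (INR n + 1 + alpha)) by lra.
    apply Rle_trans with (Rabs r * (Rabs (bessel_coeff alpha (S n)) * Rabs (r ^ n)));
      [right; ring |].
    rewrite (Rmult_assoc ((INR n + 1) * (INR n + 1 + alpha))).
    apply Rmult_le_compat_r.
    - apply Rmult_le_pos; apply Rabs_pos.
    - nra. }
  destruct (CV_radius (bessel_coeff alpha)) as [r | |].
  - generalize (H (r + 1)). simpl. lra.
  - easy.
  - now generalize (H 0).
Qed.

(** [y |-> C_alpha(- y)], where [C_alpha] is the Bessel-Clifford function. *)
Definition bessel_clifford (alpha : R) : R -> R := PSeries (bessel_coeff alpha).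

Lemma bessel_clifford_ode (alpha : R) : exists E1 E2 : R -> R,
  (forall y, is_derive (bessel_clifford alpha) y (E1 y)) /\
  (forall y, is_derive E1 y (E2 y)) /\
  (forall y, y * E2 y + (alpha + 1) * E1 y = - bessel_clifford alpha y).
Proof.
  set (c := bessel_coeff alpha).
  assert (H0 : forall y, Rbar_lt (Rabs y) (CV_radius c))
    by (intros y; unfold c; rewrite CV_radius_bessel_coeff; easy).
  assert (H1 : forall y, Rbar_lt (Rabs y) (CV_radius (PS_derive c)))
    by (intros y; rewrite CV_radius_derive; apply H0).
  assert (H2 : forall y, Rbar_lt (Rabs y) (CV_radius (PS_derive (PS_derive c))))
    by (intros y; rewrite CV_radius_derive; apply H1).
  exists (PSeries (PS_derive c)), (PSeries (PS_derive (PS_derive c))).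
  split; [| split]; intros y.
  - now apply is_derive_PSeries.
  - now apply is_derive_PSeries.
  - rewrite <- PSeries_incr_1, <- PSeries_scal.
    rewrite <- PSeries_plus.
    + unfold bessel_clifford. fold c. rewrite <- PSeries_opp.
      apply PSeries_ext. intros n.
      assert (Hrec := bessel_coeff_rec alpha n). fold c in Hrec.
      change (PS_opp c n) with (- c n). rewrite <- Hrec.
      destruct n as [|n]; unfold PS_plus, PS_scal, PS_incr_1, PS_derive;
        rewrite ?S_INR; unfold plus, scal, zero; cbn -[INR]; unfold mult; cbn -[INR].
      * change (INR 0) with 0. change (INR 1) with 1. ring.
      * match goal with |- ?l = ?r => change (@eq R l r) end. ring.
    + apply ex_pseries_incr_1. now apply CV_radius_inside.
    + apply ex_pseries_scal; [apply Rmult_comm | now apply CV_radius_inside].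
Qed.

(** * Oscillation *)

(** Sturm comparison of [u = x^(alpha + 1/2) E(x^2/4)] with [sin((x - a)/2)]. *)
Lemma not_pos_on_period_of_bessel_ode (E E1 E2 : R -> R) (alpha a : R) :
  (forall y, is_derive E y (E1 y)) ->
  (forall y, is_derive E1 y (E2 y)) ->
  (forall y, y * E2 y + (alpha + 1) * E1 y = - E y) ->
  0 < a -> 2 * Rabs alpha <= a ->
  ~ (forall x, a <= x <= a + 2 * PI -> 0 < E (x ^ 2 / 4)).
Proof.
  intros HE HE1 Hode Ha Haa Hpos.
  assert (Hpi := PI_RGT_0).
  set (s := alpha + / 2).
  (* [W] is the Wronskian [u' v - u v']; [dW] is [(1/4 - q) u v] where [u'' = - q u]. *)
  set (W := fun x => exp (s * ln x) *
    ((s / x * E (x ^ 2 / 4) + x / 2 * E1 (x ^ 2 / 4)) * sin ((x - a) / 2)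
     - E (x ^ 2 / 4) * (cos ((x - a) / 2) / 2))).
  set (dW := fun x => exp (s * ln x) * E (x ^ 2 / 4) * sin ((x - a) / 2)
    * ((alpha ^ 2 - / 4) / x ^ 2 - 3 / 4)).
  assert (HW : forall x, 0 < x -> is_derive W x (dW x)).
  { intros x Hx. unfold W, dW. auto_derive.
    - repeat split; try lra; eexists; [apply HE | apply HE1 | apply HE].
    - change (fun u => E u) with E. change (fun u => E1 u) with E1.
      rewrite (is_derive_unique _ _ _ (HE (x * (x * 1) * / 4))).
      rewrite (is_derive_unique _ _ _ (HE1 (x * (x * 1) * / 4))).
      assert (Hy := Hode (x * (x * 1) * / 4)).
      replace (x ^ 2 / 4) with (x * (x * 1) * / 4) by (unfold Rdiv; ring).
      replace ((x - a) / 2) with ((x + - a) * / 2) by (unfold Rdiv; ring).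
      set (y := x * (x * 1) * / 4) in *.
      (* The equation eliminates the second derivative. *)
      assert (HEy : E2 y = 4 / x ^ 2 * (- E y - (alpha + 1) * E1 y)).
      { rewrite <- Hy. unfold y. field. lra. }
      rewrite HEy. unfold s. field. lra. }
  destruct (MVT_gen W a (a + 2 * PI) dW) as [x [Hx Hmvt]].
  - rewrite Rmin_left, Rmax_right by lra. intros x Hx. apply HW. lra.
  - rewrite Rmin_left, Rmax_right by lra. intros x Hx.
    apply derivable_continuous_pt. exists (dW x).
    apply is_derive_Reals. apply HW. lra.
  - rewrite Rmin_left, Rmax_right in Hx by lra.
    assert (Hright : dW x <= 0).
    { unfold dW. apply Ropp_le_cancel. rewrite Ropp_0, Ropp_mult_distr_r.
      apply Rmult_le_pos; [apply Rmult_le_pos; [apply Rmult_le_pos |] |].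
      - left. apply exp_pos.
      - left. now apply Hpos.
      - apply sin_ge_0; lra.
      - assert (Hsq : alpha ^ 2 <= x ^ 2 / 4).
        { rewrite <- (pow2_abs alpha). assert (H := Rabs_pos alpha). nra. }
        assert (Hx2 : 0 < x ^ 2) by (apply pow_lt; lra).
        assert ((alpha ^ 2 - / 4) / x ^ 2 <= / 4); [| lra].
        apply Rcomplements.Rle_div_l; [easy | lra]. }
    assert (HWa : W a < 0).
    { unfold W. replace ((a - a) / 2) with 0 by field. rewrite sin_0, cos_0.
      assert (He := exp_pos (s * ln a)). assert (H := Hpos a ltac:(lra)). nra. }
    assert (HWb : 0 < W (a + 2 * PI)).
    { unfold W. replace ((a + 2 * PI - a) / 2) with PI by field. rewrite sin_PI, cos_PI.
      assert (He := exp_pos (s * ln (a + 2 * PI))).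
      assert (H := Hpos (a + 2 * PI) ltac:(lra)). nra. }
    nra.
Qed.

(** A continuous function without zeros on the half-line keeps its sign there,
    and the equation is invariant under [E |-> - E]. *)
Lemma zero_of_bessel_ode (E E1 E2 : R -> R) (alpha a : R) :
  (forall y, is_derive E y (E1 y)) ->
  (forall y, is_derive E1 y (E2 y)) ->
  (forall y, y * E2 y + (alpha + 1) * E1 y = - E y) ->
  0 < a -> 2 * Rabs alpha <= a ->
  exists x, a <= x /\ E (x ^ 2 / 4) = 0.
Proof.
  intros HE HE1 Hode Ha Haa.
  destruct (Classical_Prop.classic (exists x, a <= x /\ E (x ^ 2 / 4) = 0))
    as [H | Hno]; [exact H | exfalso].
  set (f := fun x => E (x ^ 2 / 4)).
  assert (Hf : continuity f).
  { intros x. apply derivable_continuous_pt. apply ex_derive_Reals_0.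
    unfold f. auto_derive. eexists. apply HE. }
  assert (Hsign : forall x, a <= x -> ~ Rmin (f a) (f x) <= 0 <= Rmax (f a) (f x)).
  { intros x Hx H. destruct (IVT_gen f a x 0 Hf H) as [t [[Ht _] Hft]].
    apply Hno. exists t. split; [| exact Hft].
    now rewrite Rmin_left in Ht. }
  destruct (Rlt_le_dec 0 (f a)) as [Hfa | Hfa].
  - apply (not_pos_on_period_of_bessel_ode E E1 E2 alpha a HE HE1 Hode Ha Haa).
    intros x Hx. apply Rnot_le_lt. intros Hle. apply (Hsign x); [lra |].
    fold (f x) in Hle. rewrite Rmin_right, Rmax_left by lra. lra.
  - apply (not_pos_on_period_of_bessel_ode (fun y => - E y) (fun y => - E1 y)
      (fun y => - E2 y) alpha a); try easy.
    + intros y. apply (is_derive_opp E), HE.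
    + intros y. apply (is_derive_opp E1), HE1.
    + intros y. rewrite <- Hode. ring.
    + intros x Hx. apply Rnot_le_lt. intros Hle. apply (Hsign x); [lra |].
      fold (f x) in Hle. rewrite Rmin_left, Rmax_right by lra. lra.
Qed.

(** * Zeros of the Bessel function *)

Lemma CpowZ_shift (w : C) (m : nat) (k : Z) : w <> RtoC 0 ->
  CpowZ w (2 * Z.of_nat m + k) = Cmult (CpowZ w k) (Cpow w (2 * m)).
Proof.
  intros Hw.
  assert (Hnat : forall n, CpowZ w (Z.of_nat n) = Cpow w n).
  { intros [|n]; [easy |]. simpl CpowZ. now rewrite SuccNat2Pos.id_succ. }
  assert (Hneg : forall n, CpowZ w (- Z.of_nat n) = Cinv (Cpow w n)).
  { intros [|n]; [simpl; field; injection; lra |].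
    simpl CpowZ. now rewrite SuccNat2Pos.id_succ. }
  destruct (Z_le_gt_dec 0 k) as [Hk | Hk].
  - replace k with (Z.of_nat (Z.to_nat k)) by lia.
    rewrite Hnat. rewrite <- Cpow_add_r, <- Hnat. f_equal. lia.
  - set (n := Z.to_nat (- k)). replace k with (- Z.of_nat n)%Z by lia. rewrite Hneg.
    destruct (Nat.le_gt_cases n (2 * m)) as [Hle | Hlt].
    + replace (2 * Z.of_nat m + - Z.of_nat n)%Z with (Z.of_nat (2 * m - n)) by lia.
      rewrite Hnat. replace (2 * m)%nat with (n + (2 * m - n))%nat at 2 by lia.
      rewrite Cpow_add_r. field. now apply Cpow_nz.
    + replace (2 * Z.of_nat m + - Z.of_nat n)%Z with (- Z.of_nat (n - 2 * m))%Z by lia.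
      rewrite Hneg. replace (Cpow w n) with (Cpow w (2 * m + (n - 2 * m))) by (f_equal; lia).
      rewrite Cpow_add_r. field. split; now apply Cpow_nz.
Qed.

Lemma Bessel_power_shift (alpha : R) (w : C) : w <> RtoC 0 ->
  exists P : C, forall m, Bessel_power alpha m w = Cmult P (Cpow w (2 * m)).
Proof.
  intros Hw. unfold Bessel_power. destruct (Req_dec_T (frac_part alpha) 0).
  - exists (CpowZ w (Int_part alpha)). intros m. now apply CpowZ_shift.
  - now exists (Cexp (Cmult (RtoC alpha) (Clog w))).
Qed.

(** The factor [P] is [(x/2)^alpha].  The series of real and imaginary parts are
    then real multiples of one real series. *)
Lemma BesselJ_real (alpha x : R) : 0 < x -> exists P : C,
  BesselJ alpha (RtoC x) = Cmult P (RtoC (bessel_clifford alpha (x ^ 2 / 4))).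
Proof.
  intros Hx.
  assert (Hx2 : Cdiv (RtoC x) (RtoC 2) = RtoC (x / 2)) by now rewrite RtoC_div.
  destruct (Bessel_power_shift alpha (RtoC (x / 2))) as [P HP]; [injection; lra |].
  exists P.
  assert (Hterm : forall m, BesselJ_term alpha (RtoC x) m
            = Cmult P (RtoC (bessel_coeff alpha m * (x ^ 2 / 4) ^ m))).
  { intros m. unfold BesselJ_term. rewrite Hx2, HP.
    fold (bessel_coeff alpha m).
    replace ((x ^ 2 / 4) ^ m) with ((x / 2) ^ (2 * m))
      by (rewrite pow_mult; f_equal; field).
    rewrite RtoC_mult, RtoC_pow. ring. }
  assert (Hsum : bessel_clifford alpha (x ^ 2 / 4)
            = Series (fun m => bessel_coeff alpha m * (x ^ 2 / 4) ^ m)) by easy.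
  unfold BesselJ, CSeries.
  rewrite (Series_ext _ (fun m => Re P * (bessel_coeff alpha m * (x ^ 2 / 4) ^ m)))
    by (intros m; rewrite Hterm; apply re_scal_r).
  rewrite (Series_ext (fun n => Im _) (fun m => Im P * (bessel_coeff alpha m * (x ^ 2 / 4) ^ m)))
    by (intros m; rewrite Hterm; apply im_scal_r).
  rewrite !Series_scal_l, <- Hsum.
  rewrite <- re_scal_r, <- im_scal_r. now rewrite <- surjective_pairing.
Qed.

Lemma Finite_Cmod_bounded (A : Ensemble C) :
  Finite_sets.Finite C A -> exists M, forall z, Ensembles.In C A z -> Cmod z <= M.
Proof.
  induction 1 as [|A HA [M HM] z Hz].
  - exists 0. intros z [].
  - exists (Rmax M (Cmod z)). intros u [u' Hu | u' Hu].
    + eapply Rle_trans; [now apply HM | apply Rmax_l].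
    + destruct Hu. apply Rmax_r.
Qed.

Theorem theorem3p2 (alpha : R) :
  ~ Finite_sets.Finite C (BesselJ_zeros alpha).
Proof.
  intros Hfin. destruct (Finite_Cmod_bounded _ Hfin) as [M HM].
  destruct (bessel_clifford_ode alpha) as (E1 & E2 & HE & HE1 & Hode).
  assert (Habs := Rabs_pos alpha). assert (HabsM := Rabs_pos M).
  destruct (zero_of_bessel_ode _ E1 E2 alpha (Rabs M + 1 + 2 * Rabs alpha) HE HE1 Hode)
    as [x [Hx Hzero]]; [lra | lra |].
  assert (HxM : Cmod (RtoC x) <= M).
  { apply HM. split.
    - right. injection. lra.
    - destruct (BesselJ_real alpha x) as [P ->]; [lra |]. rewrite Hzero. ring. }
  rewrite Cmod_R, Rabs_pos_eq in HxM by lra.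
  generalize (RRle_abs M). lra.
Qed.
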